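(* If $\alpha$ is an algebraic number with $|M_\alpha(1)|=1$, then $\alpha\notin\mathcal{F}_{|M_\alpha(0)|}$.
   Context: For $S\subset\mathbb{C}$ and $\alpha\in\mathbb{C}$, $S[\alpha]:=\{\sum_{j=0}^n f_j\alpha^j : n\in\mathbb{N},\ (f_0,\ldots,f_n)\in S^{n+1}\}$. For an algebraic number $\alpha$, $M_\alpha\in\mathbb{Z}[x]$ is its primitive minimal polynomial over $\mathbb{Q}$ (integer coefficients with gcd $1$). For an algebraic number $\alpha$ for which some finite $S\subset\mathbb{C}$ satisfies $\mathbb{Z}[\alpha]=S[\alpha]$, let $S_\alpha$ denote such a finite set of minimal cardinality; for $N\in\mathbb{N}$, $\mathcal{F}_N$ is the set of algebraic numbers $\alpha$ for which such a set exists and $\operatorname{Card}(S_\alpha)=N$. *)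

(* Defs.v *)
From HB Require Import structures.
From mathcomp Require Export all_boot all_order all_algebra.
From mathcomp Require Export complex.
From mathcomp Require Export boolp classical_sets functions cardinality reals.

Set Implicit Arguments.
Unset Strict Implicit.
Unset Printing Implicit Defensive.

Import Order.TTheory GRing.Theory Num.Theory.

Local Open Scope classical_set_scope.
Local Open Scope card_scope.
Local Open Scope ring_scope.

Section Defs.
Variable R : realType.
Local Notation C := R[i].

Definition is_algebraic (a : C) : Prop := algebraicOver (ratr : rat -> C) a.

(* M is only determined up to sign; both choices satisfy the predicate. The
   sign of [zcontents M] is that of the leading coefficient of M. *)
Definition primitive_minpoly (a : C) (M : {poly int}) : Prop :=
  [/\ M != 0,
      `|zcontents M| = 1,
      root (map_poly (intr : int -> C) M) a
    & forall q : {poly rat}, q != 0 ->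
        root (map_poly (ratr : rat -> C) q) a -> (size M <= size q)%N].

Definition adjoin_digits (S : set C) (a : C) : set C :=
  [set z | exists (n : nat) (f : 'I_n.+1 -> C),
     (forall j, S (f j)) /\ z = \sum_(j < n.+1) f j * a ^+ j].

Definition integers : set C := range (intr : int -> C).

Definition digit_set (a : C) (S : set C) : Prop :=
  finite_set S /\ adjoin_digits integers a = adjoin_digits S a.

Definition F_ (N : nat) : set C :=
  [set a | is_algebraic a /\
     exists S : set C, [/\ digit_set a S,
       (forall T : set C, digit_set a T -> S #<= T)
       & S #= `I_N]].

Lemma primitive_minpoly_exists (a : C) :
  is_algebraic a -> exists M, primitive_minpoly a M.
Proof.
move=> [p0 p0N0 p0a].
pose P n := `[< exists p : {poly rat}, [/\ p != 0,
  root (map_poly (ratr : rat -> C) p) a & size p = n] >].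
have exP : exists n, P n by exists (size p0); apply/asboolP; exists p0.
case: (ex_minnP exP) => n /asboolP[p [pN0 pa <-]] pmin.
have [q [c cN0 pE]] := rat_poly_scale p.
have qN0 : q != 0.
  by apply: contraNneq pN0 => q0; rewrite pE q0 rmorph0 scaler0.
have cqN0 : zcontents q != 0 by rewrite zcontents_eq0.
have c'N0 : c%:~R^-1 != 0 :> rat by rewrite invr_eq0 intr_eq0.
have szE : size p = size (zprimitive q).
  by rewrite pE size_scale// size_map_inj_poly ?size_zprimitive//; exact: intr_inj.
exists (zprimitive q); split.
- by rewrite zprimitive_eq0.
- by rewrite zcontents_primitive qN0.
- move: pa; rewrite pE map_polyZ /= {1}[q]zpolyEprim !map_polyZ /=.
  rewrite !rootZ //; last 2 first.
  + by rewrite ratr_int intr_eq0.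
  + by rewrite fmorph_eq0.
  rewrite -map_poly_comp; congr is_true; congr root.
  by apply: eq_map_poly => z /=; rewrite ratr_int.
- move=> r rN0 ra; rewrite -szE; apply: pmin; apply/asboolP.
  by exists r.
Qed.

End Defs.

(* Main.v *)
Require Import Defs.
From mathcomp Require Import all_boot all_order all_algebra.
From mathcomp Require Import complex.
From mathcomp Require Import boolp classical_sets functions cardinality reals.
From mathcomp Require Import ring.

Import Order.TTheory GRing.Theory Num.Theory.

Local Open Scope classical_set_scope.
Local Open Scope ring_scope.

(** Evaluation at 0 identifies Z[a]/(a) with Z/M(0), and each element of S[a]
    is congruent modulo a to its digit of index 0.  Hence a digit set with
    |M(0)| elements contains exactly one element of each class modulo a, and
    the digits of an element of Z[a] are forced one after the other.  If
    |M(1)| = 1, then 1 - a is a unit of Z[a], so for every digit s the element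
    z = s / (1 - a) lies in Z[a].  As z = s + a z, all digits of z are forced to
    be s and the remainder is always z; since the expansion of z is finite,
    z = 0 and s = 0.  So 0 is the only digit, which is absurd. *)

Section IntegerPolynomialValues.
Variables (R : realType) (a : R[i]).

Definition int_eval (p : {poly int}) : R[i] := (map_poly intr p).[a].

Lemma int_evalD p q : int_eval (p + q) = int_eval p + int_eval q.
Proof. by rewrite /int_eval rmorphD hornerD. Qed.

Lemma int_evalB p q : int_eval (p - q) = int_eval p - int_eval q.
Proof. by rewrite /int_eval rmorphB hornerD hornerN. Qed.

Lemma int_evalM p q : int_eval (p * q) = int_eval p * int_eval q.
Proof. by rewrite /int_eval rmorphM hornerM. Qed.

Lemma int_evalC c : int_eval c%:P = c%:~R.
Proof. by rewrite /int_eval map_polyC hornerC. Qed.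

Lemma int_evalX : int_eval 'X = a.
Proof. by rewrite /int_eval map_polyX hornerX. Qed.

Lemma adjoin_integersP z :
  adjoin_digits (@integers R) a z <-> exists p, z = int_eval p.
Proof.
split=> [[n [f [fZ ->]]]|[p ->]].
  have /choice[c cE] : forall j, exists c : int, f j = c%:~R.
    by move=> j; have [c _ <-] := fZ j; exists c.
  exists (\sum_(j < n.+1) (c j)%:P * 'X^j).
  rewrite /int_eval rmorph_sum horner_sum; apply: eq_bigr => j _.
  by rewrite rmorphM /= map_polyC map_polyXn hornerM hornerC hornerXn cE.
(* One digit more than the size, so that [p = 0] needs no separate case. *)
exists (size p), (fun j => (p`_j)%:~R); split; first by move=> j; exists p`_j.
rewrite /int_eval (@horner_coef_wide _ (size p).+1); last first.
  by rewrite (leq_trans (size_poly _ _)).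
by apply: eq_bigr => j _; rewrite coef_map.
Qed.

(** Congruence modulo the ideal of Z[a] generated by [a]. *)
Definition cong_base (z w : R[i]) : Prop := exists p, z - w = a * int_eval p.

Lemma cong_base_sym z w : cong_base z w -> cong_base w z.
Proof.
move=> [p zw]; exists (0 - p).
by rewrite int_evalB int_evalC mulrBr -zw mulr0 sub0r opprB.
Qed.

Lemma cong_base_trans y z w : cong_base z y -> cong_base y w -> cong_base z w.
Proof.
move=> [p zy] [q yw]; exists (p + q).
by rewrite int_evalD mulrDr -zy -yw addrA subrK.
Qed.

Lemma int_eval_cong_coef0 p : cong_base (int_eval p) (p`_0)%:~R.
Proof.
have /factor_theorem[q qE] : root (p - (p`_0)%:P) 0.
  by rewrite /root hornerD hornerN hornerC horner_coef0 subrr.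
exists q; rewrite -int_evalC -int_evalB qE subr0 int_evalM int_evalX.
by rewrite mulrC.
Qed.

Section MinimalPolynomial.
Variable M : {poly int}.
Hypothesis M_minpoly : primitive_minpoly a M.

Lemma int_eval_minpoly : int_eval M = 0.
Proof. by case: M_minpoly => _ _ /rootP. Qed.

(** Over the rationals the remainder of [p] by [M] vanishes at [a], so it is 0 by minimality;
    Gauss's lemma brings the quotient back to integer coefficients. *)
Lemma minpoly_dvd p : int_eval p = 0 -> exists r, p = M * r.
Proof.
case: M_minpoly => M0 Mcont _ Mmin pa.
have ratr_intr q : map_poly ratr (map_poly intr q : {poly rat}) =
    map_poly intr q :> {poly R[i]}.
  by rewrite -map_poly_comp; apply: eq_map_poly => c /=; rewrite ratr_int.
have : (M %| p)%R.
  rewrite -dvdp_rat_int; set Mq := map_poly _ M; set pq := map_poly _ p.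
  have Mq0 : Mq != 0 by rewrite map_poly_eq0_id0 // intr_eq0 lead_coef_eq0.
  apply/modp_eq0P; apply: contrapT => /eqP r0.
  have := ltn_modpN0 pq Mq0; rewrite ltnNge => /negP[].
  rewrite size_map_inj_poly //; last exact: intr_inj.
  apply: (Mmin _ r0); apply/rootP.
  have -> : pq %% Mq = pq - pq %/ Mq * Mq by rewrite {2}(divp_eq pq Mq) addrC addKr.
  rewrite rmorphB rmorphM /= !ratr_intr hornerD hornerN hornerM.
  have -> : (map_poly intr p).[a] = 0 by [].
  have -> : (map_poly intr M).[a] = 0 by exact: int_eval_minpoly.
  by rewrite mulr0 subrr.
(* Here [r] is the quotient by [zprimitive M], which equals [M] up to the sign [zcontents M]. *)
move=> /dvdpP_int[r ->]; exists (zcontents M *: r).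
rewrite {2}[M]zpolyEprim -scalerAl -scalerAr scalerA.
have -> : zcontents M * zcontents M = 1 by rewrite -expr2 -real_normK ?num_real // Mcont.
by rewrite scale1r.
Qed.

(** The polynomial [b - c - 'X * p] vanishes at [a], so it is a multiple of [M]; evaluate at 0. *)
Lemma cong_base_int (b c : int) :
  cong_base b%:~R c%:~R -> (M.[0] %| b - c)%Z.
Proof.
move=> [p]; rewrite -!int_evalC -int_evalB -{1}int_evalX -int_evalM => /eqP.
rewrite -subr_eq0 -int_evalB => /eqP/minpoly_dvd[r /(congr1 (horner^~ 0))].
rewrite !(hornerE, mul0r, subr0) => ->; exact: dvdz_mulr.
Qed.

(** Evaluating M - M(1) = q (X - 1) at [a] gives M(1) = q(a) (1 - a), and M(1) is its own
    inverse. *)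
Lemma one_sub_base_unit : `|M.[1]| = 1 -> exists p, int_eval p * (1 - a) = 1.
Proof.
move=> M1; have /factor_theorem[q qE] : root (M - (M.[1])%:P) 1.
  by rewrite /root hornerD hornerN hornerC subrr.
exists ((M.[1])%:P * q); rewrite int_evalM int_evalC.
have := congr1 int_eval qE.
rewrite int_evalM !int_evalB int_evalC int_evalX int_evalC int_eval_minpoly.
rewrite sub0r => h.
have -> : (M.[1])%:~R * int_eval q * (1 - a) =
   - (M.[1])%:~R * (int_eval q * (a - 1)) by ring.
rewrite -h mulrNN -rmorphM /= -expr2 -real_normK ?num_real // M1.
by rewrite expr1n.
Qed.

Section DigitSet.
Variable S : set R[i].
Hypothesis S_adjoin : adjoin_digits (@integers R) a = adjoin_digits S a.

Lemma adjoin_digitsP z : adjoin_digits S a z <-> exists p, z = int_eval p.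
Proof. by rewrite -S_adjoin; exact: adjoin_integersP. Qed.

Lemma digit_int_eval s : S s -> exists p, s = int_eval p.
Proof.
move=> Ss; apply/adjoin_digitsP; exists 0%N, (fun=> s); split=> //.
by rewrite big_ord1 mulr1.
Qed.

Lemma digits_cong n (f : 'I_n.+1 -> R[i]) : (forall j, S (f j)) ->
  cong_base (\sum_(j < n.+1) f j * a ^+ j) (f ord0).
Proof.
(* A lone digit is treated apart, since its tail would be empty and expansions have at least one
   digit. *)
case: n f => [|n] f fS.
  by exists 0; rewrite big_ord1 mulr1 subrr int_evalC mulr0.
have /adjoin_digitsP[p pE] :
    adjoin_digits S a (\sum_(j < n.+1) f (lift ord0 j) * a ^+ j).
  by exists n, (fun j => f (lift ord0 j)).
exists p; rewrite -pE big_ord_recl mulr1 [_ - _]addrC addKr mulr_sumr.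
by apply: eq_bigr => j _; rewrite exprS; ring.
Qed.

(** Pigeonhole: expanding each residue i < N gives a digit [d i] congruent to i. These N digits are
    distinct, so they exhaust [S], one per class. *)
Lemma digit_cong_eq s t : (S #= `I_(`|M.[0]|%N))%card -> S s -> S t ->
  cong_base s t -> s = t.
Proof.
set N := `|M.[0]|%N => /card_set_bijP[g [gN gI _]] Ss St st.
have /choice[d dP] : forall i : 'I_N, exists s, S s /\ cong_base s i%:Z%:~R.
  move=> i; have /adjoin_digitsP[n [f [fS fE]]] : exists p, i%:Z%:~R = int_eval p.
    by exists (i%:Z)%:P; rewrite int_evalC.
  exists (f ord0); split=> //; apply: cong_base_sym.
  by rewrite fE; exact: digits_cong.
have dS i := (dP i).1; have dC i := (dP i).2.
have ord_cong (i j : 'I_N) : cong_base i%:Z%:~R j%:Z%:~R -> i = j.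
  move=> /cong_base_int; rewrite -eqz_mod_dvd -!(modz_abs _ M.[0]) -/N.
  by rewrite !modz_small ?lez_nat ?ltz_nat ?ltn_ord // => /eqP[/val_inj].
have gP s' : S s' -> (g s' < N)%N by exact: gN.
(* Numbering digits by [g] turns [d] into a self-map of ['I_N], for which injective implies
   surjective. *)
pose sigma i := Ordinal (gP _ (dS i)).
have sigma_inj : injective sigma.
  move=> i j /(congr1 val) /= gij; apply: ord_cong.
  have dij : d i = d j by apply: gI => //; exact/mem_set.
  by apply: cong_base_trans (dC j); rewrite -dij; exact/cong_base_sym.
have [tau _ tauK] := injF_bij sigma_inj.
have digitE s' (Ss' : S s') : s' = d (tau (Ordinal (gP _ Ss'))).
  apply: gI; [exact/mem_set | exact/mem_set |].
  by have /(congr1 val) /= := tauK (Ordinal (gP _ Ss')).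
rewrite (digitE s Ss) (digitE t St) in st *.
congr d; apply: ord_cong.
apply: cong_base_trans (dC _); apply: cong_base_trans st.
exact/cong_base_sym.
Qed.

(** Induction on the length: the index-0 digit must be [s], and cancelling [s] and then [a] expands
    the same [z] with one digit fewer. A single digit gives z = s, so a z = 0. *)
Lemma fixed_expansion_eq0 s z n (f : 'I_n.+1 -> R[i]) :
  (S #= `I_(`|M.[0]|%N))%card -> a != 0 -> S s -> z = s + a * z ->
  (forall j, S (f j)) -> z = \sum_(j < n.+1) f j * a ^+ j -> z = 0.
Proof.
move=> SN a0 Ss zs; elim: n f => [|n IHn] f fS zE.
all: have /adjoin_digitsP[p pE] : adjoin_digits S a z by exists _, f.
all: have fs : f ord0 = s by
  apply: digit_cong_eq => //;
  (apply: (@cong_base_trans z);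
     [by apply: cong_base_sym; rewrite zE; exact: digits_cong
     |by exists p; rewrite -pE {1}zs addrC addKr]).
  move: zs; rewrite {1}zE big_ord1 mulr1 fs -{1}[s]addr0 => /addrI/esym/eqP.
  by rewrite mulf_eq0 (negbTE a0) => /eqP.
apply: (IHn (fun j => f (lift ord0 j))) => //.
apply: (mulfI a0); move: zs; rewrite {1}zE big_ord_recl mulr1 fs => /addrI <-.
by rewrite mulr_sumr; apply: eq_bigr => j _; rewrite exprS; ring.
Qed.

End DigitSet.
End MinimalPolynomial.
End IntegerPolynomialValues.

Theorem theorem2 (R : realType) (a : R[i]) (M : {poly int})
    (a_algebraic : is_algebraic a) (M_minpoly : primitive_minpoly a M)
    (M1 : `|M.[1]| = 1) :
  ~ F_ `|M.[0]|%N a.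
Proof.
move=> [_ [S [[_ SE] _ SN]]].
have [n [f [fS fE]]] : adjoin_digits S a 1.
  by apply/(adjoin_digitsP _ _ _ SE); exists 1%:P; rewrite int_evalC.
(* If a = 0 then M(0) = 0, so [S] would be empty, yet it contains a digit of 1. *)
have a0 : a != 0.
  have [g [gN _ _]] := card_set_bijP SN.
  apply: contraTneq (leq_ltn_trans (leq0n _) (gN _ (fS ord0))) => a0.
  rewrite lt0n negbK absz_eq0 -(@intr_eq0 R[i]).
  have := int_eval_minpoly _ _ _ M_minpoly.
  by rewrite /int_eval a0 !horner_coef0 coef_map => ->.
have [u uE] := one_sub_base_unit _ _ _ M_minpoly M1.
have S0 s : S s -> s = 0.
  move=> Ss; have [p pE] := digit_int_eval _ _ _ SE _ Ss.
  (* The element [s * int_eval _ a u] is s / (1 - a), the fixed point of z = s + a z. *)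
  have [m [h [hS hE]]] : adjoin_digits S a (s * int_eval _ a u).
    by apply/(adjoin_digitsP _ _ _ SE); exists (p * u); rewrite int_evalM pE.
  have zs : s * int_eval _ a u = s + a * (s * int_eval _ a u).
    by rewrite -{2}[s]mulr1 -uE; ring.
  have := fixed_expansion_eq0 _ _ _ M_minpoly _ SE _ _ _ _ SN a0 Ss zs hS hE.
  by move=> z0; move: zs; rewrite z0 mulr0 addr0.
move/eqP: fE; rewrite big1 ?oner_eq0 // => j _.
by rewrite (S0 _ (fS j)) mul0r.
Qed.
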